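(* Let $(c_n)_{n\ge 0}$ be i.i.d. random variables with values in $[0,1]$ (write $c$ for a generic one), with mean $\mu$ and variance $\sigma^2$, independent of a random variable $r_0$ with values in $[0,1]$. Define $r_{n+1}=T(c_n,r_n)$ and $\ell_{n+1}=\ell(c_n,r_n)$ for $n\ge 0$, with $T$ and $\ell$ as given in the context, and let $\mu_{\ell_n}$ and $\sigma_{\ell_n}^2$ denote the mean and variance of $\ell_n$. If $r_0$ is absolutely continuous and $\mathbb{P}[0<c<1]>0$, then, as $n\to\infty$, $$\mu_{\ell_n}\longrightarrow 1-2(\mu-\mu^2-\sigma^2),\qquad \sigma_{\ell_n}^2\longrightarrow(\mu-\mu^2-\sigma^2)\bigl(1-4(\mu-\mu^2-\sigma^2)\bigr).$$
   Context: For $c,r\in[0,1]$, $$T(c,r)=\begin{cases}\dfrac{r}{c} & \text{if } c\ge r,\\[2mm] \dfrac{r-c}{1-c} & \text{if } c<r,\end{cases}\qquad \ell(c,r)=\begin{cases} c & \text{if } c\ge r,\\ 1-c & \text{if } c<r,\end{cases}$$ with the convention $T(0,0)=0$. ''Absolutely continuous'' means that the random variable admits a probability density function on $[0,1]$. Here $r_n$ is the relative position of the root in the current interval (rescaled to $[0,1]$), $c_n$ the relative position of the random cut, and $\ell_{n+1}$ the factor by which the interval length is multiplied at that step of the stochastic bisection method. *)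

(* Defs.v *)
From HB Require Import structures.
From mathcomp Require Import all_boot all_order all_algebra finmap.
From mathcomp Require Import all_classical all_reals all_analysis.
Import Order.TTheory GRing.Theory Num.Theory.
Import numFieldNormedType.Exports.

Set Implicit Arguments.
Unset Strict Implicit.
Unset Printing Implicit Defensive.

Local Open Scope classical_set_scope.
Local Open Scope ring_scope.

(* Since 0^-1 = 0, this gives the convention T(0,0) = 0.  The second branch is
   reached only when c < r, so for c, r in [0,1] its denominator is nonzero. *)
Definition bisection_root {R : realType} (c r : R) : R :=
  if r <= c then r / c else (r - c) / (1 - c).

Definition bisection_factor {R : realType} (c r : R) : R :=
  if r <= c then c else 1 - c.

Section random_variables.
Context {d : measure_display} {Omega : measurableType d} {R : realType}.
Variable P : probability Omega R.
Local Open Scope ereal_scope.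

Definition mutually_independent (X : nat -> {RV P >-> R}) : Prop :=
  forall (J : {fset nat}) (B : nat -> set R), (forall i, measurable (B i)) ->
    P (\bigcap_(i in [set` J]) (X i @^-1` B i)) =
    \prod_(i <- J) P (X i @^-1` B i).

Definition identically_distributed (X : nat -> {RV P >-> R}) : Prop :=
  forall (m n : nat) (B : set R), measurable B ->
    distribution P (X m) B = distribution P (X n) B.

(* The sigma-algebra on Omega generated by the whole sequence X. *)
Definition sequence_sigma_algebra (X : nat -> {RV P >-> R}) : set (set Omega) :=
  <<s \bigcup_n preimage_set_system setT (X n) measurable >>.

Definition independent_of_sequence
    (Y : {RV P >-> R}) (X : nat -> {RV P >-> R}) : Prop :=
  forall (A : set Omega) (B : set R),
    sequence_sigma_algebra X A -> measurable B ->
    P (A `&` Y @^-1` B) = P A * P (Y @^-1` B).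

Definition has_density_on_unit_interval (Y : {RV P >-> R}) : Prop :=
  exists f : R -> R,
    [/\ measurable_fun (`[0%R, 1%R]%classic : set R) f,
        (forall x, (0 <= x <= 1)%R -> (0 <= f x)%R) &
        forall B : set R, measurable B ->
          distribution P Y B =
          \int[lebesgue_measure]_(x in B `&` `[0%R, 1%R]%classic) (f x)%:E].

End random_variables.

(* Main.v *)
Require Import Defs.
From HB Require Import structures.
From mathcomp Require Import all_boot all_order all_algebra finmap.
From mathcomp Require Import all_classical all_reals all_analysis.
From mathcomp Require Import measurable_realfun ring lra.
Import Order.TTheory GRing.Theory Num.Theory.
Import numFieldNormedType.Exports.

Local Open Scope classical_set_scope.
Local Open Scope ring_scope.

(** The relative position of the root becomes uniform on [[0, 1]] in the limit.
    Once it is uniform and independent of the cut [c], the factor equals [c]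
    with conditional probability [c] and [1 - c] with conditional probability
    [1 - c]. Its first two moments are then
    [E (c ^ 2 + (1 - c) ^ 2) = 1 - 2 * a] and
    [E (c ^ 3 + (1 - c) ^ 3) = 1 - 3 * a], where
    [a = E (c * (1 - c)) = mu - mu ^ 2 - sigma ^ 2], and the variance is
    [1 - 3 * a - (1 - 2 * a) ^ 2 = a * (1 - 4 * a)].

    The convergence is proved, uniformly, for the distribution functions [F n] of
    the positions. Given the cut, the next position is at most [x] when the
    current one lies in [[0, c * x]] or in [(c, c + (1 - c) * x]]; since cut and
    position are independent, this gives the linear recursion
    [F (n + 1) x = E (F n (c * x) + F n (c + (1 - c) * x) - F n c)]
    ([root_cdfS]), of which the identity is a fixed point.

    The distance of [F n] to the identity is controlled by the midpoint defects
    [F a + F b - 2 * F ((a + b) / 2)]: a function equal to 0 at 0 and to 1 at 1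
    whose defects are all small is close to the identity
    ([midpoint_bound_dist_id]). The recursion replaces the defect over [[a, b]]
    by the mean of the sum of the defects over two intervals, [c] times and
    [1 - c] times as long. A bound of the form [K * (b - a) ^ 2] on the defects
    therefore improves by the factor [E (c ^ 2 + (1 - c) ^ 2)], which is less
    than 1 because the cut is strictly inside with positive probability, while
    bounds of the form [eps * (b - a)] and [E b - E a], for a nondecreasing [E]
    that undergoes the same recursion, are preserved ([cdf_step_midpoint]).

    At the start, the density of [r0] is within [eps] in [L^1] of a continuous
    function, and a continuous function is Lipschitz up to [eps]. Hence the
    defects of the initial distribution function admit such a bound, with a
    possibly large [K] and with [eps] and the mass of [E] as small as desired
    ([density_midpoint_bound]). Iteration kills the term in [K]. *)

(** * Midpoint defects *)

Section midpoint.
Context {R : realType}.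
Implicit Types F E : R -> R.

(** A symmetric second difference: it vanishes on every affine function, and an
    affine change of variable turns it into the defect over the image
    interval. *)
Definition midpoint_defect F a b := F a + F b - 2 * F ((a + b) / 2).

(** The three terms stand for three sources of curvature of a primitive [F] of
    [f], when [f] is close in [L^1] to a continuous [g]: the oscillation [eps]
    and the slope [K] of [g], then the mass of [f - g], whose primitive is [E].
    Only the slope term is quadratic in the length of the interval, and this
    is what makes it contract under subdivision. *)
Definition midpoint_bound F E eps K :=
  forall a b, 0 <= a -> a <= b -> b <= 1 ->
    `|midpoint_defect F a b| <= eps * (b - a) + K * (b - a) ^+ 2 + (E b - E a).

(** Put [G x = F x - x], which vanishes at 0 and 1 and has the same midpoint
    defects as [F]. Each [x] in [[0, 1]] is the midpoint of an interval with
    endpoint 0 or 1, so the defect over it reads [2 * G x - G y], whence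
    [2 * sup |G| <= B + sup |G|]. The supremum is avoided by iterating the
    resulting improvement of any bound [S] to [(S + B) / 2]. *)
Lemma midpoint_bound_dist_id F E eps K eta :
  0 <= eps -> 0 <= K -> {homo E : x y / x <= y} -> E 1 - E 0 <= eta ->
  F 0 = 0 -> F 1 = 1 -> (forall x, 0 <= x <= 1 -> 0 <= F x <= 1) ->
  midpoint_bound F E eps K ->
  forall x, 0 <= x <= 1 -> `|F x - x| <= eps + K + eta.
Proof.
move=> e0 K0 Ehomo Eeta F0 F1 F01 mF.
set B := eps + K + eta.
have defect_le a b : 0 <= a -> a <= b -> b <= 1 -> `|midpoint_defect F a b| <= B.
  move=> a0 ab b1; apply: le_trans (mF _ _ a0 ab b1) _.
  have h1 : E b <= E 1 by exact: Ehomo.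
  have h0 : E 0 <= E a by exact: Ehomo.
  have h2 : eps * (b - a) <= eps by rewrite ler_piMr//; lra.
  have h3 : K * (b - a) ^+ 2 <= K by rewrite ler_piMr// expr_le1//; lra.
  by rewrite /B; lra.
have B0 : 0 <= B by apply: le_trans (defect_le 0 0 _ _ _).
have halve S : (forall x, 0 <= x <= 1 -> `|F x - x| <= S) ->
    forall x, 0 <= x <= 1 -> `|F x - x| <= (S + B) / 2.
  move=> hS x /andP[x0 x1].
  have [x2|x2] := leP x (1 / 2).
    have := hS (2 * x); have := defect_le 0 (2 * x); rewrite /midpoint_defect F0.
    have -> : (0 + 2 * x) / 2 = x by field.
    move=> /(_ ltac:(lra) ltac:(lra) ltac:(lra)) h /(_ ltac:(lra)).
    by move: h; rewrite !ler_norml; lra.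
  have := hS (2 * x - 1); have := defect_le (2 * x - 1) 1.
  rewrite /midpoint_defect F1.
  have -> : (2 * x - 1 + 1) / 2 = x by field.
  move=> /(_ ltac:(lra) ltac:(lra) ltac:(lra)) h /(_ ltac:(lra)).
  by move: h; rewrite !ler_norml; lra.
have iter_halve k : forall x, 0 <= x <= 1 -> `|F x - x| <= B + (1 / 2) ^+ k.
  elim: k => [|k IH] x x01.
    have := F01 _ x01; rewrite expr0 ler_norml; lra.
  apply: le_trans (halve _ IH x x01) _; rewrite exprS; lra.
move=> x x01; apply/ler_addgt0Pr => e e_gt0.
have : (1 / 2 : R) ^+ k @[k --> \oo] --> (0 : R).
  by apply: cvg_expr; rewrite ger0_norm; lra.
move/cvgrPdist_lt => /(_ _ e_gt0) [k _ /(_ k (leqnn k))] /=.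
rewrite sub0r normrN => hk.
apply: le_trans (iter_halve k x x01) _; rewrite lerD2l ltW//.
exact: le_lt_trans (ler_norm _) hk.
Qed.

End midpoint.

(** * The evolution of a distribution function under a random cut *)

Section cdf_step.
Context {d : measure_display} {Omega : measurableType d} {R : realType}.
Variables (P : probability Omega R) (X : {RV P >-> R}).
Hypothesis X01 : forall w, 0 <= X w <= 1.
Implicit Types F E : R -> R.

Lemma bounded_integrable (Y : Omega -> R) (M : R) :
  measurable_fun setT Y -> (forall w, `|Y w| <= M) ->
  P.-integrable setT (EFin \o Y).
Proof.
move=> mY bY; apply: measurable_bounded_integrable => //.
  by rewrite (@le_lt_trans _ _ 1%E) ?ltry ?probability_le1.
exists M; split; first exact: num_real.
by move=> y My w _ /=; exact: le_trans (bY w) (ltW My).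
Qed.

Lemma nondecreasing_comp_integrable F (Y : Omega -> R) (M : R) :
  {homo F : x y / x <= y} -> measurable_fun setT Y -> (forall w, `|Y w| <= M) ->
  P.-integrable setT (EFin \o (F \o Y)).
Proof.
move=> homoF mY bY; apply: (@bounded_integrable _ (`|F (- M)| + `|F M|)).
  by apply: measurableT_comp mY; apply: nondecreasing_measurable.
move=> w /=; have := bY w; rewrite ler_norml => /andP[/homoF h1 /homoF h2].
have := ler_norm (F M); have := ler_norm (- F (- M)); rewrite normrN.
have := normr_ge0 (F M); have := normr_ge0 (F (- M)).
by rewrite ler_norml; lra.
Qed.

Definition cdf_integrand F x w := F (X w * x) + F (X w + (1 - X w) * x) - F (X w).

(** If [F] is the distribution function of a root [r] in [[0, 1]] and [X] is an
    independent cut, then [cdf_step F] is on [[0, 1]] the distribution function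
    of the next relative position: given [X = t], it is at most [x] exactly when
    [r] lies in [[0, t * x]] or in [(t, t + (1 - t) * x]]. *)
Definition cdf_step F x := \int[P]_w cdf_integrand F x w.

(** A monotone [F] is measurable, and bounded on the bounded range of the three
    arguments. *)
Lemma cdf_integrand_integrable F x : {homo F : x y / x <= y} ->
  P.-integrable setT (EFin \o cdf_integrand F x).
Proof.
move=> homoF.
have mX : measurable_fun setT X by [].
have i1 : P.-integrable setT (EFin \o (F \o (fun w => X w * x))).
  apply: (@nondecreasing_comp_integrable _ _ `|x|) => //.
    exact: measurable_funM.
  move=> w /=.
  by have /andP[? ?] := X01 w; rewrite normrM ler_piMl// ger0_norm.
have i2 : P.-integrable setT (EFin \o (F \o (fun w => X w + (1 - X w) * x))).
  apply: (@nondecreasing_comp_integrable _ _ (1 + `|x|)) => //.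
    by apply: measurable_funD => //; apply: measurable_funM => //;
      exact: measurable_funB.
  move=> w /=.
  have /andP[? ?] := X01 w; apply: le_trans (ler_normD _ _) _.
  apply: lerD; first by rewrite ger0_norm.
  by rewrite normrM ler_piMl// ger0_norm; lra.
have i3 : P.-integrable setT (EFin \o (F \o X)).
  apply: (@nondecreasing_comp_integrable _ _ 1) => // w.
  by have /andP[? ?] := X01 w; rewrite ger0_norm.
have := integrableB measurableT (integrableD measurableT i1 i2) i3.
by apply: eq_integrable => // w _ /=.
Qed.

Lemma cdf_step_homo F : {homo F : x y / x <= y} ->
  {homo cdf_step F : x y / x <= y}.
Proof.
move=> homoF x y xy; apply: le_Rintegral => //; try exact: cdf_integrand_integrable.
move=> w _; have /andP[? ?] := X01 w.
rewrite lerD2r lerD// homoF// ?lerD2l ler_wpM2l//; lra.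
Qed.

Lemma cdf_step0 F : cdf_step F 0 = F 0.
Proof.
rewrite /cdf_step /cdf_integrand.
under eq_Rintegral do rewrite !mulr0 addr0 addrK.
by rewrite Rintegral_cst//= probability_setT /= mulr1.
Qed.

Lemma cdf_step1 F : cdf_step F 1 = F 1.
Proof.
rewrite /cdf_step /cdf_integrand.
under eq_Rintegral do rewrite !mulr1 subrKC addrC addKr.
by rewrite Rintegral_cst//= probability_setT /= mulr1.
Qed.

Definition contraction_rate := \int[P]_w (X w ^+ 2 + (1 - X w) ^+ 2).

Lemma contraction_rate_integrable :
  P.-integrable setT (EFin \o (fun w => X w ^+ 2 + (1 - X w) ^+ 2)).
Proof.
apply: (@bounded_integrable _ 1).
  apply: measurable_funD; apply: measurable_funX => //; exact: measurable_funB.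
move=> w; have /andP[? ?] := X01 w; rewrite ger0_norm; nra.
Qed.

Lemma contraction_rate_ge0 : 0 <= contraction_rate.
Proof. by apply: Rintegral_ge0 => w _; rewrite addr_ge0// sqr_ge0. Qed.

(** For a fixed cut [t] the interval [[a, b]] is sent to two intervals, of
    lengths [t * (b - a)] and [(1 - t) * (b - a)], and the midpoint to their
    midpoints. Lengths add up to [b - a], which preserves [eps]; squared lengths
    add up to [(t ^ 2 + (1 - t) ^ 2) * (b - a) ^ 2], which shrinks [K]. *)
Lemma cdf_step_midpoint F E eps K :
  {homo F : x y / x <= y} -> {homo E : x y / x <= y} ->
  midpoint_bound F E eps K ->
  midpoint_bound (cdf_step F) (cdf_step E) eps (contraction_rate * K).
Proof.
move=> homoF homoE mF a b a0 ab b1.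
pose k := cdf_integrand.
have ik x := cdf_integrand_integrable _ x homoF.
have ikE x := cdf_integrand_integrable _ x homoE.
have intM c f : P.-integrable setT (EFin \o f) ->
    P.-integrable setT (EFin \o (fun w => c * f w)).
  by move=> /(integrableZl measurableT c); apply: eq_integrable.
have intD f g : P.-integrable setT (EFin \o f) -> P.-integrable setT (EFin \o g) ->
    P.-integrable setT (EFin \o (fun w => f w + g w)).
  by move=> i1 i2; have := integrableD measurableT i1 i2; apply: eq_integrable.
have intB f g : P.-integrable setT (EFin \o f) -> P.-integrable setT (EFin \o g) ->
    P.-integrable setT (EFin \o (fun w => f w - g w)).
  by move=> i1 i2; have := integrableB measurableT i1 i2; apply: eq_integrable.
have intC (c : R) : P.-integrable setT (EFin \o (fun=> c)).
  by apply: (@bounded_integrable _ `|c|).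
have iquad : P.-integrable setT
    (EFin \o (fun w => K * (b - a) ^+ 2 * (X w ^+ 2 + (1 - X w) ^+ 2))).
  exact: intM contraction_rate_integrable.
pose m := (a + b) / 2.
have -> : midpoint_defect (cdf_step F) a b =
    \int[P]_w (k F a w + k F b w - 2 * k F m w).
  rewrite RintegralB//; [|exact: intD|exact: intM].
  by rewrite RintegralD// RintegralZl.
have -> : eps * (b - a) + contraction_rate * K * (b - a) ^+ 2 +
      (cdf_step E b - cdf_step E a) =
    \int[P]_w (eps * (b - a) + K * (b - a) ^+ 2 * (X w ^+ 2 + (1 - X w) ^+ 2)
               + (k E b w - k E a w)).
  have iconst := intC (eps * (b - a)).
  rewrite (RintegralD measurableT (intD _ _ iconst iquad) (intB _ _ (ikE b) (ikE a))).
  rewrite (RintegralD measurableT iconst iquad).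
  rewrite (RintegralB measurableT (ikE b) (ikE a)).
  rewrite (RintegralZl (K * (b - a) ^+ 2) measurableT contraction_rate_integrable).
  rewrite Rintegral_cst//= probability_setT /= mulr1 -/contraction_rate.
  by rewrite [_ * K]mulrC mulrAC.
have idefect : P.-integrable setT (EFin \o (fun w => k F a w + k F b w - 2 * k F m w)).
  by apply: intB; [exact: intD|exact: intM].
apply: le_trans (le_normr_Rintegral measurableT idefect) _.
apply: le_Rintegral => //.
- by have := integrable_abse idefect; apply: eq_integrable.
- exact: intD _ _ (intD _ _ (intC _) iquad) (intB _ _ (ikE b) (ikE a)).
move=> w _; have /andP[c0 c1] := X01 w.
set c := X w in c0 c1 *.
have h1 := mF (c * a) (c * b) ltac:(nra) ltac:(nra) ltac:(nra).
have h2 := mF (c + (1 - c) * a) (c + (1 - c) * b) ltac:(nra) ltac:(nra) ltac:(nra).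
have -> : k F a w + k F b w - 2 * k F m w =
    midpoint_defect F (c * a) (c * b) +
    midpoint_defect F (c + (1 - c) * a) (c + (1 - c) * b).
  rewrite /midpoint_defect /k /cdf_integrand -/c.
  have -> : (c * a + c * b) / 2 = c * m by rewrite /m; field.
  have -> : (c + (1 - c) * a + (c + (1 - c) * b)) / 2 = c + (1 - c) * m.
    by rewrite /m; field.
  by ring.
apply: le_trans (ler_normD _ _) _; apply: le_trans (lerD h1 h2) _.
rewrite le_eqVlt; apply/orP; left; apply/eqP.
by rewrite /k /cdf_integrand -/c; ring.
Qed.

Lemma contraction_rateE :
  contraction_rate = 1 - 2 * \int[P]_w (X w * (1 - X w)).
Proof.
have i1 : P.-integrable setT (EFin \o (fun w => X w * (1 - X w))).
  apply: (@bounded_integrable _ 1).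
    by apply: measurable_funM => //; exact: measurable_funB.
  by move=> w; have /andP[? ?] := X01 w; rewrite ger0_norm; nra.
have i2 : P.-integrable setT (EFin \o (fun w => 2 * (X w * (1 - X w)))).
  by have := integrableZl measurableT 2 i1; apply: eq_integrable.
have iconst : P.-integrable setT (EFin \o (fun=> 1)).
  by apply: (@bounded_integrable _ `|1|).
rewrite -(RintegralZl 2 measurableT i1).
have {1}-> : (1 : R) = \int[P]_w 1 by rewrite Rintegral_cst//= probability_setT mulr1.
rewrite -(RintegralB measurableT iconst i2).
by apply: eq_Rintegral => w _; ring.
Qed.

(** The rate is 1 only when [X * (1 - X)] vanishes almost surely, that is, when
    the cut almost never falls strictly inside the interval. *)
Lemma contraction_rate_lt1 : (0 < P [set w | (0 < X w < 1)%R])%E ->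
  contraction_rate < 1.
Proof.
move=> inner; rewrite contraction_rateE ltrBlDr ltrDl mulr_gt0//.
have ge0 w : 0 <= X w * (1 - X w) by have /andP[? ?] := X01 w; nra.
rewrite lt_neqAle Rintegral_ge0// andbT.
apply/negP => /eqP i0.
have mf : measurable_fun setT (fun w => X w * (1 - X w)).
  by apply: measurable_funM => //; exact: measurable_funB.
have intf : P.-integrable setT (EFin \o (fun w => X w * (1 - X w))).
  apply: (@bounded_integrable _ 1) => //.
  by move=> w; have /andP[? ?] := X01 w; rewrite ger0_norm; nra.
have : (\int[P]_w `|(X w * (1 - X w))%:E| = 0)%E.
  under eq_integral do rewrite gee0_abs ?lee_fin//.
  rewrite -[LHS]fineK; last exact: integrable_fin_num intf.
  by congr (_%:E); rewrite i0.
move/(ae_eq_integral_abs P measurableT) => [|N [mN PN sN]].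
  exact/measurable_EFinP.
suff : (P [set w | (0 < X w < 1)%R] <= P N)%E by rewrite PN leNgt inner.
have mI : measurable [set w | (0 < X w < 1)%R].
  have -> : [set w | (0 < X w < 1)%R] = X @^-1` `]0, 1[%classic.
    by apply/seteqP; split=> w /=; rewrite in_itv.
  exact: measurable_funPTI.
apply: le_measure; rewrite ?inE// => w /= /andP[? ?]; apply: sN => /= /(_ I).
by move=> [] /eqP; rewrite mulf_eq0 => /orP[] /eqP; clear PN; lra.
Qed.

End cdf_step.

(** * Distribution functions with a density *)

Section density.
Context {R : realType}.
Local Notation mu := (@lebesgue_measure R).

(** A function continuous on a compact interval is Lipschitz up to an arbitrarily
    small error: uniform continuity handles close points, and boundedness
    handles distant ones at the price of a large [K]. This is proved in one
    compactness argument, in which [K] tends to infinity. *)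
Lemma continuous_itv_modulus (g : R -> R) (eps : R) : continuous g -> 0 < eps ->
  exists2 K : R, 0 <= K & forall s t, 0 <= s <= 1 -> 0 <= t <= 1 ->
    `|g s - g t| <= eps + K * `|s - t|.
Proof.
move=> cg eps0.
have [B B0 gB] : exists2 B, 0 <= B & forall t, 0 <= t <= 1 -> `|g t| <= B.
  have cgI : {within `[0, 1]%classic : set R, continuous g}.
    exact: continuous_subspaceT.
  have [M [_ hM]] := compact_bounded (continuous_compact cgI (@segment_compact R 0 1)).
  exists (`|M| + 1) => [|t t01]; first by rewrite addr_ge0.
  apply: hM; first by rewrite ltr_pwDr// ler_norm.
  by exists t => //=; rewrite in_itv.
have := (compact_near_coveringP _).1 (@segment_compact R 0 1).
move=> /(_ R (pinfty_nbhs R)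
  (fun K s => forall t, 0 <= t <= 1 -> `|g s - g t| <= eps + K * `|s - t|) _).
case=> [x|].
  rewrite /= in_itv/= => x01.
  have /cvgrPdist_lt /(_ (eps / 2) ltac:(lra)) := cg x.
  move=> /nbhs_ballP[del /= del0 gx].
  exists (ball x (del / 2), [set K | 4 * B / del < K]).
    split; first by apply: nbhsx_ballx; lra.
    by exists (4 * B / del); split => //; exact: num_real.
  move=> [s K] [/= xs BK] t t01.
  have K0 : 0 <= K by apply: le_trans (ltW BK); rewrite divr_ge0 ?mulr_ge0// ltW.
  have Kst : 0 <= K * `|s - t| by rewrite mulr_ge0.
  have gxs : `|g x - g s| < eps / 2.
    by apply: gx => /=; rewrite /ball/= (lt_trans xs)//; lra.
  have [xt|xt] := ltP `|x - t| del.
    have gxt : `|g x - g t| < eps / 2 by apply: gx.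
    by move: gxs gxt; rewrite !ltr_norml ler_norml; lra.
  have st : del / 2 <= `|s - t|.
    have := ler_distD s x t; move: xs; rewrite /ball/=; lra.
  have gs : `|g s| <= B + eps / 2.
    by have := gB _ x01; move: gxs; rewrite !ltr_norml !ler_norml; lra.
  have Kst4 : 2 * B <= K * `|s - t|.
    have -> : 2 * B = 4 * B / del * (del / 2) by field; rewrite gt_eqF.
    apply: ler_pM (ltW BK) st; last by lra.
    by apply: divr_ge0 (ltW del0); exact: mulr_ge0.
  by have := gB _ t01; move: gs; rewrite !ler_norml; lra.
move=> M [Mreal /(_ (`|M| + 1))] h.
exists (`|M| + 1) => [|s t s01 t01]; first by rewrite addr_ge0.
by apply: h => //=; rewrite ?in_itv// ltr_pwDr// ler_norm.
Qed.

Lemma unit_itv_lty : (mu `[0%R, 1%R]%classic < +oo)%E.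
Proof. by rewrite lebesgue_measure_itv/= lte_fin ltr01 -EFinB ltry. Qed.

(** Integrate [f - y = (f - g) + (g - y)] over the interval. *)
Lemma Rintegral_near_cst (f g : R -> R) (p q y del : R) :
  mu.-integrable `[0, 1]%classic (EFin \o f) ->
  mu.-integrable `[0, 1]%classic (EFin \o g) ->
  0 <= p -> p <= q -> q <= 1 ->
  (forall t, p < t <= q -> `|g t - y| <= del) ->
  `|\int[mu]_(t in `]p, q]) f t - (q - p) * y| <=
  \int[mu]_(t in `]p, q]) `|f t - g t| + (q - p) * del.
Proof.
move=> intf intg p0 pq q1 gy.
have sub : `]p, q]%classic `<=` `[0, 1]%classic.
  by move=> t /=; rewrite !in_itv/= => /andP[? ?]; lra.
have len c : \int[mu]_(t in `]p, q]) c = (q - p) * c.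
  transitivity (c * fine (mu `]p, q]%classic)); first exact: Rintegral_cst.
  rewrite lebesgue_measure_itv/= lte_fin mulrC.
  case: ltP => [_|qp]; first by rewrite -EFinB.
  by have -> : q = p by [apply/eqP; rewrite eq_le qp]; rewrite subrr.
have icst c : mu.-integrable `]p, q]%classic (EFin \o (fun=> c)).
  suff : mu.-integrable `[0, 1]%classic (EFin \o (fun=> c)) by exact: integrableS.
  apply: measurable_bounded_integrable => //.
    exact: unit_itv_lty.
  by exists `|c|; split => [|x cx t _ /=]; [exact: num_real|exact: ltW].
have iF : mu.-integrable `]p, q]%classic (EFin \o f) by exact: integrableS intf.
have iG : mu.-integrable `]p, q]%classic (EFin \o g) by exact: integrableS intg.
have ifg : mu.-integrable `]p, q]%classic (EFin \o (fun t => f t - g t)).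
  by apply: eq_integrable (integrableB _ iF iG).
have iabs : mu.-integrable `]p, q]%classic (EFin \o (fun t => `|f t - g t|)).
  by apply: eq_integrable (integrable_abse ifg).
have ify : mu.-integrable `]p, q]%classic (EFin \o (fun t => f t - y)).
  by apply: eq_integrable (integrableB _ iF (icst y)).
rewrite -!len -(RintegralB _ iF (icst y))// -(RintegralD _ iabs (icst del))//.
apply: le_trans (le_normr_Rintegral _ ify) _ => //.
apply: le_Rintegral => //.
- by apply: eq_integrable (integrable_abse ify).
- by apply: eq_integrable (integrableD _ iabs (icst del)).
move=> t /=; rewrite in_itv/= => /gy.
by have := ler_distD (g t) (f t) y; lra.
Qed.

(** Choose a continuous [g] within [eps] of [f] in [L^1]. On the two halves of
    [[a, b]] the integrals of [f] both differ little from half the length times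
    the value of [g] at the midpoint, so they differ little from each other. *)
Lemma density_midpoint_bound (f : R -> R) (eps : R) :
  mu.-integrable `[0, 1]%classic (EFin \o f) -> 0 < eps ->
  exists E K, [/\ {homo E : x y / x <= y}, 0 <= K, E 1 - E 0 <= eps &
    midpoint_bound (fun x => \int[mu]_(t in `[0, x]) f t) E eps K].
Proof.
move=> intf eps0.
have Ifin := unit_itv_lty.
have [|g_ [cg intg]] := approximation_continuous_integrable _ Ifin intf.
  exact: measurable_itv.
move=> /fine_cvgP[_ /cvgrPdist_lt /(_ _ eps0)].
case=> N _ /(_ N (leqnn N)) /=; rewrite sub0r normrN.
set g := g_ N => small.
have [K K0 gK] := continuous_itv_modulus _ _ (cg N) eps0; rewrite -/g in gK.
have ifg : mu.-integrable `[0, 1]%classic (EFin \o (fun t => f t - g t)).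
  by apply: eq_integrable (integrableB _ intf (intg N)).
have iabs : mu.-integrable `[0, 1]%classic (EFin \o (fun t => `|f t - g t|)).
  by apply: eq_integrable (integrable_abse ifg).
(* The truncation makes E monotone on the whole line although f - g is only
   known to be integrable on the unit interval. *)
pose E x := \int[mu]_(t in `[0, Num.min x 1]) `|f t - g t|.
have sub (x : R) : x <= 1 -> `[0, x]%classic `<=` `[0, 1]%classic.
  by move=> x1 t /=; rewrite !in_itv/= => /andP[? ?]; lra.
have isub (x : R) (h : R -> R) : mu.-integrable `[0, 1]%classic (EFin \o h) -> x <= 1 ->
    mu.-integrable `[0, x]%classic (EFin \o h).
  by move=> ih x1; apply: integrableS ih => //; exact: sub.
exists E, K; split => //.
- move=> x y xy.
  have minle (z : R) : Num.min z 1 <= 1 by rewrite ge_min lexx orbT.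
  rewrite /E /Rintegral; apply: fine_le.
  + by apply: integrable_fin_num => //; apply: isub.
  + by apply: integrable_fin_num => //; apply: isub.
  + apply: ge0_subset_integral => //.
      exact: measurable_int (isub _ _ iabs (minle y)).
    move=> t /=; rewrite !in_itv/= => /andP[-> /=] /le_trans; apply.
    by rewrite le_min !ge_min xy lexx orbT.
- rewrite /E !minxx (min_idPl ler01) set_itv1 Rintegral_set1 subr0.
  apply: ltW; apply: le_lt_trans (ler_norm _) _.
  by move: small; rewrite /Rintegral.
move=> a b a0 ab b1.
pose m := (a + b) / 2.
have split_at (h : R -> R) x y : mu.-integrable `[0, 1]%classic (EFin \o h) ->
    0 <= x -> x <= y -> y <= 1 ->
    \int[mu]_(t in `[0, y]) h t - \int[mu]_(t in `[0, x]) h t =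
    \int[mu]_(t in `]x, y]) h t.
  by move=> ih x0 xy y1; rewrite Rintegral_itvB//; exact: isub.
have am : a <= m by rewrite /m; lra.
have mb : m <= b by rewrite /m; lra.
have m01 : 0 <= m <= 1 by lra.
have Emin x : x <= 1 -> E x = \int[mu]_(t in `[0, x]) `|f t - g t|.
  by move=> x1; rewrite /E (min_idPl x1).
have Edif x y : 0 <= x -> x <= y -> y <= 1 ->
    \int[mu]_(t in `]x, y]) `|f t - g t| = E y - E x.
  by move=> x0 xy y1; rewrite !Emin ?split_at//; lra.
pose del := eps + K * (b - a).
have near_m x y : a <= x -> y <= b -> forall t, x < t <= y -> `|g t - g m| <= del.
  move=> ax yb t /andP[xt ty]; apply: le_trans (gK _ _ _ m01) _; first lra.
  by rewrite lerD2l ler_wpM2l// ler_norml /m; lra.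
have m0 : 0 <= m by exact: le_trans am.
have m1 : m <= 1 by exact: le_trans b1.
have a1 : a <= 1 by exact: le_trans m1.
have b0 : 0 <= b by exact: le_trans mb.
have := Rintegral_near_cst _ _ _ _ _ _ intf (intg N) a0 am m1 (near_m _ _ (lexx a) mb).
have := Rintegral_near_cst _ _ _ _ _ _ intf (intg N) m0 mb b1 (near_m _ _ am (lexx b)).
rewrite -/g (Edif _ _ a0 am m1) (Edif _ _ m0 mb b1).
rewrite -(split_at _ _ _ intf a0 am m1) -(split_at _ _ _ intf m0 mb b1).
have -> : m - a = (b - a) / 2 by rewrite /m; field.
have -> : b - m = (b - a) / 2 by rewrite /m; field.
have -> : (b - a) / 2 * del = (eps * (b - a) + K * (b - a) ^+ 2) / 2.
  by rewrite /del; field.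
rewrite /midpoint_defect -/m.
move: (_ / 2 * g m) (eps * _ + _) (E a) (E b) (E m) => u v Ea Eb Em.
move: (Rintegral _ _ _) (Rintegral _ _ _) (Rintegral _ _ _) => Fb Fm Fa.
clear.
by rewrite !ler_norml; lra.
Qed.

End density.

(** * Independence and integration over the cut and the root *)

Section independence.
Context {d : measure_display} {Omega : measurableType d} {R : realType}.
Variable P : probability Omega R.
Local Open Scope ereal_scope.

(** When [W] has positive probability, the law of the pair conditioned on [W]
    agrees with the product of the laws on rectangles, hence everywhere. The
    event [W] is what lets independence from the future propagate along the
    process. *)
Lemma independent_pair_law (X Y : {RV P >-> R}) (W : set Omega) :
  measurable W ->
  (forall A B, measurable A -> measurable B ->
    P (X @^-1` A `&` Y @^-1` B `&` W) = P (X @^-1` A) * P (Y @^-1` B) * P W) ->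
  forall D : set (R * R), measurable D ->
    P ((fun w => (X w, Y w)) @^-1` D `&` W) =
    (distribution P X \x distribution P Y) D * P W.
Proof.
move=> mW indep D mD.
pose Z w := (X w, Y w).
have mZ : measurable_fun setT Z by exact: measurable_fun_pair.
pose Zm : {mfun Omega >-> (R * R)%type} := HB.pack Z (isMeasurableFun.Build _ _ _ _ _ mZ).
have PWfin : P W \is a fin_num by exact: fin_num_measure.
have [PW0|PW0] := eqVneq (P W) 0.
  rewrite PW0 mule0; apply/eqP; rewrite eq_le measure_ge0 andbT -PW0.
  apply: le_measure; rewrite ?inE//; apply: measurableI => //.
  exact: (measurable_funPTI Zm).
have PWgt0 : (0 < fine (P W))%R.
  by rewrite fine_gt0// lt0e PW0 measure_ge0 ltey_eq PWfin.
have inv0 : (0 <= (fine (P W))^-1)%R by rewrite invr_ge0 ltW.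
pose m := mscale (NngNum inv0) (mrestr P mW).
have mE (A B : set R) : measurable A -> measurable B ->
    pushforward m Z (A `*` B) = distribution P X A * distribution P Y B.
  move=> mA mB; rewrite /m /pushforward /mscale /= /mrestr.
  have -> : Z @^-1` (A `*` B) = X @^-1` A `&` Y @^-1` B by [].
  rewrite indep// muleC -muleA -{1}(fineK PWfin) -EFinM divff ?mule1//.
  by rewrite gt_eqF.
have uniq := @product_measure_unique _ _ _ _ _ (distribution P X)
  (distribution P Y) (pushforward m Z).
rewrite (uniq mZ mE _ mD) /m /pushforward /mscale /= /mrestr.
by rewrite muleAC -{2}(fineK PWfin) -EFinM mulVf ?mul1e// gt_eqF.
Qed.

(** Fubini-Tonelli for the joint law, pulled back to the sample space: the two
    variables may be evaluated at independent sample points. *)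
Lemma independent_integral (X Y : {RV P >-> R}) (h : R * R -> \bar R) :
  (forall A B, measurable A -> measurable B ->
    P (X @^-1` A `&` Y @^-1` B) = P (X @^-1` A) * P (Y @^-1` B)) ->
  measurable_fun setT h -> (forall z, 0 <= h z) ->
  \int[P]_w h (X w, Y w) = \int[P]_w \int[P]_w' h (X w, Y w').
Proof.
move=> indep mh h0.
pose Z w := (X w, Y w).
have mZ : measurable_fun setT Z by exact: measurable_fun_pair.
pose Zm : {mfun Omega >-> (R * R)%type} := HB.pack Z (isMeasurableFun.Build _ _ _ _ _ mZ).
transitivity (\int[distribution P Zm]_z h z).
  by rewrite ge0_integral_distribution.
transitivity (\int[distribution P X \x distribution P Y]_z h z).
  apply: eq_measure_integral => D mD _.
  have := @independent_pair_law X Y setT measurableT _ D mD.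
  rewrite setIT probability_setT mule1; apply=> A B mA mB.
  by rewrite setIT indep// mule1.
rewrite fubini_tonelli1// ge0_integral_distribution//; last 2 first.
- exact: measurable_fun_fubini_tonelli_F.
- by move=> x; apply: integral_ge0.
apply: eq_integral => w _ /=.
rewrite /fubini_F ge0_integral_distribution//.
exact: measurableT_comp mh _.
Qed.

End independence.

Section bisection_measurable.
Context {R : realType}.

(** A visibly measurable form of [bisection_root]: real powers are measurable, and
    exponent -1 gives the inverse on nonnegative numbers, including 0. *)
Definition bisection_root_powR (p : R * R) : R :=
  if p.2 <= p.1 then p.2 * p.1 `^ (-1) else (p.2 - p.1) * (1 - p.1) `^ (-1).

Lemma bisection_root_powRE c r : 0 <= c <= 1 ->
  bisection_root c r = bisection_root_powR (c, r).
Proof.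
move=> /andP[c0 c1]; rewrite /bisection_root /bisection_root_powR /=.
by rewrite !powR_inv1// subr_ge0.
Qed.

Lemma measurable_bisection_root_powR : measurable_fun setT bisection_root_powR.
Proof.
apply: measurable_fun_ifT.
- exact: measurable_fun_ler.
- apply: measurable_funM => //.
  exact: (measurableT_comp (measurable_powR (-1)%R)).
- apply: measurable_funM; first exact: measurable_funB.
  apply: (measurableT_comp (measurable_powR (-1)%R)) => //.
  exact: measurable_funB.
Qed.

End bisection_measurable.

Section future.
Context {d : measure_display} {Omega : measurableType d} {R : realType}.
Variables (P : probability Omega R) (c : nat -> {RV P >-> R}).
Hypothesis c_indep : mutually_independent c.

(** The finite cylinders over the cuts of index at least [n]. They form a class
    stable enough for the induction on [n], and the product rule computes their
    probabilities. *)
Definition future_event (n : nat) (W : set Omega) :=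
  exists (J : {fset nat}) (B : nat -> set R),
    [/\ forall i, i \in J -> (n <= i)%N, forall i, measurable (B i) &
        W = \bigcap_(i in [set` J]) (c i @^-1` B i)].

Lemma future_event_setT n : future_event n setT.
Proof.
exists fset0, (fun=> setT); split => //.
by rewrite set_fset0 bigcap_set0.
Qed.

Lemma future_event_measurable n W : future_event n W -> measurable W.
Proof.
move=> [J [B [_ mB ->]]]; apply: bigcap_measurableType => i _.
exact: measurable_funPTI.
Qed.

Lemma future_event_in_sigma_algebra n W :
  future_event n W -> sequence_sigma_algebra c W.
Proof.
move=> [J [B [_ mB ->]]].
rewrite /sequence_sigma_algebra; set G := \bigcup_n _.
have [S0 SC SU] := smallest_sigma_algebra setT G.
rewrite -[\bigcap_(i in _) _]setCK -setTD.
apply: (SC _ _); rewrite setC_bigcap bigcup_mkcond.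
apply: SU => i; case: ifPn => // _.
rewrite -setTD; apply: (SC _ _); apply: sub_sigma_algebra.
by exists i => //; exists (B i) => //; rewrite setTI.
Qed.

(** Adjoining the constraint on the [n]-th cut, of a new index, adds one factor
    to the product rule. *)
Lemma future_event_cons n (A : set R) W : measurable A -> future_event n.+1 W ->
  future_event n (c n @^-1` A `&` W) /\
  P (c n @^-1` A `&` W) = (P (c n @^-1` A) * P W)%E.
Proof.
move=> mA [J [B [Jn mB ->]]].
have nJ : n \notin J by apply/negP => /Jn; rewrite ltnn.
pose B' i := if i == n then A else B i.
have mB' i : measurable (B' i) by rewrite /B'; case: ifP.
have B'J i : i \in J -> B' i = B i.
  by move=> iJ; rewrite /B'; case: eqP => // ein; move: iJ; rewrite ein (negPf nJ).
have eqW : c n @^-1` A `&` \bigcap_(i in [set` J]) (c i @^-1` B i) =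
    \bigcap_(i in [set` (n |` J)%fset]) (c i @^-1` B' i).
  rewrite set_fsetU1 bigcap_setU1 /B' eqxx; congr (_ `&` _).
  by apply: eq_bigcapr => i /= iJ; rewrite -/(B' i) B'J.
rewrite eqW; split.
  exists (n |` J)%fset, B'; split => // i.
  by rewrite in_fset1U => /orP[/eqP->//|/Jn /ltnW].
rewrite c_indep// c_indep// big_fsetU1//= /B' eqxx; congr (_ * _)%E.
by apply: eq_big_seq => i iJ; rewrite -/(B' i) B'J.
Qed.

End future.

Section bounded_expectations.
Context {d : measure_display} {Omega : measurableType d} {R : realType}.
Variable P : probability Omega R.

Lemma integral_bounded_EFin (Y : Omega -> R) (M : R) :
  measurable_fun setT Y -> (forall w, `|Y w| <= M) ->
  (\int[P]_w (Y w)%:E)%E = (\int[P]_w Y w)%:E.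
Proof.
move=> mY bY; rewrite [RHS]fineK//.
by apply: integrable_fin_num => //; exact: bounded_integrable bY.
Qed.

Lemma Rintegral_if (b : Omega -> bool) (x y : R) :
  measurable_fun setT b ->
  \int[P]_w (if b w then x else y) =
  x * fine (P [set w | b w]) + y * (1 - fine (P [set w | b w])).
Proof.
move=> mb.
have mS : measurable [set w | b w].
  by rewrite -[X in measurable X]setTI; exact: mb measurableT _ _.
have iS : P.-integrable setT (EFin \o \1_[set w | b w]).
  apply: (@bounded_integrable _ _ _ P _ 1) => [|w]; first exact: measurable_indic.
  by rewrite indicE; case: (_ \in _); rewrite ?normr1 ?normr0.
have iZ := integrableZl measurableT (x - y) iS.
transitivity (\int[P]_w (y + (x - y) * \1_[set w | b w] w)).
  apply: eq_Rintegral => w _; rewrite indicE.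
  have [bw|bw] := boolP (b w).
    by rewrite mem_set// mulr1 addrC subrK.
  by rewrite memNset ?mulr0 ?addr0//; exact/negP.
rewrite RintegralD//; last first.
  by apply: (@bounded_integrable _ _ _ P _ `|y|).
rewrite (RintegralZl _ measurableT iS) Rintegral_cst//= probability_setT /= mulr1.
have -> : \int[P]_w \1_[set w | b w] w = fine (P [set w | b w]).
  by rewrite /Rintegral integral_indic// setIT.
ring.
Qed.

Lemma identically_distributed_Rintegral (c : nat -> {RV P >-> R}) (g : R -> R)
    (M : R) n :
  identically_distributed c -> (forall n w, 0 <= c n w <= 1) ->
  measurable_fun setT g -> (forall x, 0 <= x <= 1 -> `|g x| <= M) ->
  \int[P]_w g (c n w) = \int[P]_w g (c 0%N w).
Proof.
move=> cid c01 mg gM; congr fine.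
have int k : P.-integrable setT ((EFin \o g) \o c k).
  apply: (@bounded_integrable _ _ _ P (g \o c k) M) => [|w]; last exact: gM.
  exact: measurableT_comp.
have mEg : measurable_fun setT (EFin \o g) by exact/measurable_EFinP.
rewrite -(integral_distribution mEg (int n)) -(integral_distribution mEg (int 0%N)).
by apply: eq_measure_integral => A mA _; exact: cid.
Qed.

End bounded_expectations.

(** * Convergence to the uniform distribution function *)

Section limit.
Context {d : measure_display} {Omega : measurableType d} {R : realType}.
Variables (P : probability Omega R) (X : {RV P >-> R}).
Hypothesis X01 : forall w, 0 <= X w <= 1.

(** Bounds [eps], [E] and [K] for [F 0] become [eps], the [n]-th step of [E] and
    [rho ^ n * K] for [F n], with [rho < 1]. The steps of [E] keep its values at
    0 and 1, hence its total mass. *)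
Lemma cdf_step_unif_cvg (F : nat -> R -> R) (eps : R) :
  (0 < P [set w | (0 < X w < 1)%R])%E ->
  (forall n, {homo F n : x y / x <= y}) ->
  (forall n x, 0 <= x <= 1 -> 0 <= F n x <= 1) ->
  F 0%N 0 = 0 -> F 0%N 1 = 1 ->
  (forall n x, 0 <= x <= 1 -> F n.+1 x = cdf_step P X (F n) x) ->
  (forall e, 0 < e -> exists E K, [/\ {homo E : x y / x <= y}, 0 <= K,
     E 1 - E 0 <= e & midpoint_bound (F 0%N) E e K]) ->
  0 < eps ->
  \forall n \near \oo, forall x, 0 <= x <= 1 -> `|F n x - x| <= eps.
Proof.
move=> inner homoF F01 F00 F010 FS approx eps0.
have [E [K [homoE K0 E01 mF0]]] := approx (eps / 3) ltac:(lra).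
pose rho := contraction_rate P X.
have rho0 : 0 <= rho by exact: contraction_rate_ge0.
pose En n := iter n (cdf_step P X) E.
have endpoints n : F n 0 = 0 /\ F n 1 = 1.
  elim: n => // n [IH0 IH1].
  by rewrite !FS ?lexx ?ler01// cdf_step0 cdf_step1.
have Einv n : [/\ {homo En n : x y / x <= y}, En n 1 - En n 0 <= eps / 3 &
    midpoint_bound (F n) (En n) (eps / 3) (rho ^+ n * K)].
  elim: n => [|n [IHh IHe IHm]]; first by rewrite expr0 mul1r.
  split; first exact: cdf_step_homo.
    by rewrite /En !iterS cdf_step1 cdf_step0.
  have step := cdf_step_midpoint P X X01 _ _ _ _ (homoF n) IHh IHm.
  move=> a b a0 ab b1; rewrite exprS -mulrA.
  apply: le_trans (step _ _ a0 ab b1).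
  by rewrite /midpoint_defect !FS//; lra.
have : rho ^+ n * K @[n --> \oo] --> (0 : R).
  rewrite -[X in _ --> X](mul0r K); apply: cvgMl.
  by apply: cvg_expr; rewrite ger0_norm// contraction_rate_lt1.
move/cvgrPdist_lt => /(_ (eps / 3) ltac:(lra)) [N _ hN].
exists N => // n /hN /=; rewrite sub0r normrN => small x x01.
have [Eh Ee Em] := Einv n.
have rK0 : 0 <= rho ^+ n * K by rewrite mulr_ge0// exprn_ge0.
have e0 : 0 <= eps / 3 by lra.
have [F0 F1] := endpoints n.
have := midpoint_bound_dist_id _ _ _ _ _ e0 rK0 Eh Ee F0 F1 (F01 n) Em x x01.
have := ler_norm (rho ^+ n * K); lra.
Qed.

End limit.

(** * The distribution of the root and of the factor *)

Section process.
Context {d : measure_display} {Omega : measurableType d} {R : realType}.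
Variables (P : probability Omega R) (c rv : nat -> {RV P >-> R}).
Hypothesis c01 : forall n w, 0 <= c n w <= 1.
Hypothesis c_indep : mutually_independent c.
Hypothesis c_ident : identically_distributed c.
Hypothesis rv01 : forall n w, 0 <= rv n w <= 1.
Hypothesis rv0_indep : independent_of_sequence (rv 0%N) c.
Hypothesis rv_step : forall n w, rv n.+1 w = bisection_root (c n w) (rv n w).

(** The next root is a function of the current root and cut. By the induction
    hypothesis and the product rule for the cuts, the current root, the current
    cut and an event depending on later cuts are independent; so the next root
    is independent of that event. *)
Lemma root_future_independent n A W : measurable A -> future_event P c n W ->
  P (rv n @^-1` A `&` W) = (P (rv n @^-1` A) * P W)%E.
Proof.
elim: n A W => [|n IH] A W mA fW.
  rewrite setIC muleC.
  exact: rv0_indep (future_event_in_sigma_algebra _ _ _ _ fW) mA.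
pose D := (@bisection_root_powR R) @^-1` A.
have mD : measurable D.
  by rewrite -[X in measurable X]setTI; exact: measurable_bisection_root_powR.
have rvD : rv n.+1 @^-1` A = (fun w => (c n w, rv n w)) @^-1` D.
  apply/seteqP; split=> w; rewrite /D /= rv_step;
    by rewrite bisection_root_powRE.
have law V : future_event P c n.+1 V ->
    P (rv n.+1 @^-1` A `&` V) =
    ((distribution P (c n) \x distribution P (rv n)) D * P V)%E.
  move=> fV; rewrite rvD; apply: independent_pair_law => //.
    exact: future_event_measurable fV.
  move=> B B' mB mB'.
  have [fBV PBV] := future_event_cons P c c_indep n B V mB fV.
  rewrite setIAC setIC IH// PBV muleC.
  by rewrite -!muleA [(P V * _)%E]muleC.
rewrite (law _ fW) -[in RHS](setIT (rv n.+1 @^-1` A)) (law _ (future_event_setT _ _ _)).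
by rewrite probability_setT mule1.
Qed.

(** The current cut alone is a future event. *)
Lemma cut_root_independent n (A B : set R) : measurable A -> measurable B ->
  P (c n @^-1` A `&` rv n @^-1` B) = (P (c n @^-1` A) * P (rv n @^-1` B))%E.
Proof.
move=> mA mB.
have [fA _] := future_event_cons P c c_indep n A _ mA (future_event_setT P c n.+1).
rewrite setIT in fA.
by rewrite setIC root_future_independent// muleC.
Qed.

Definition root_cdf n x := fine (P [set w | rv n w <= x]).

Lemma measurable_rv_le n x : measurable [set w | rv n w <= x].
Proof.
have -> : [set w | rv n w <= x] = rv n @^-1` `]-oo, x].
  by apply/seteqP; split=> w /=; rewrite in_itv.
exact: measurable_funPTI.
Qed.

Lemma root_cdf_homo n : {homo root_cdf n : x y / x <= y}.
Proof.
move=> x y xy; apply: fine_le; try exact/fin_num_measure/measurable_rv_le.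
apply: le_measure; rewrite ?inE; try exact: measurable_rv_le.
by move=> w /= /le_trans; apply.
Qed.

Lemma root_cdf01 n x : 0 <= root_cdf n x <= 1.
Proof.
rewrite /root_cdf fine_ge0//= -lee_fin fineK.
  exact/probability_le1/measurable_rv_le.
exact/fin_num_measure/measurable_rv_le.
Qed.

Lemma root_cdf1 n : root_cdf n 1 = 1.
Proof.
rewrite /root_cdf (_ : [set w | rv n w <= 1] = setT) ?probability_setT//.
by apply/seteqP; split=> w //= _; have /andP[] := rv01 n w.
Qed.

(** The event is that [rv n] lies in [[0, t * x]] or in
    [(t, t + (1 - t) * x]], two disjoint sets. *)
Lemma bisection_root_cdf n t x : 0 <= t <= 1 -> 0 <= x <= 1 ->
  fine (P [set w | bisection_root t (rv n w) <= x]) =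
  root_cdf n (t * x) + root_cdf n (t + (1 - t) * x) - root_cdf n t.
Proof.
move=> /andP[t0 t1] /andP[x0 x1].
have tx : t * x <= t by nra.
have ttx : t <= t + (1 - t) * x by nra.
have -> : [set w | bisection_root t (rv n w) <= x] =
    [set w | rv n w <= t * x] `|`
    ([set w | rv n w <= t + (1 - t) * x] `\` [set w | rv n w <= t]).
  apply/seteqP; split=> w /=; have /andP[r0 r1] := rv01 n w;
    rewrite /bisection_root.
    case: ifPn => [rt|].
      have [t_gt0|t_le0] := ltP 0 t.
        by rewrite ler_pdivrMr// mulrC => ?; left.
      have tE : t = 0 by lra.
      by left; apply: le_trans rt _; rewrite tE mul0r.
    rewrite -ltNge => tr; rewrite ler_pdivrMr; last lra.
    by move=> h; right; split => //; lra.
  case=> [h|[h /negP]].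
    rewrite (le_trans h tx).
    have [t_gt0|t_le0] := ltP 0 t; first by rewrite ler_pdivrMr// mulrC.
    have tE : t = 0 by lra.
    by rewrite tE invr0 mulr0.
  rewrite -ltNge => tr; rewrite [rv n w <= t]leNgt tr /= ler_pdivrMr; lra.
have mle := measurable_rv_le n.
rewrite measureU//; last 2 first.
- exact: measurableD.
- apply/seteqP; split=> // w [/= h [_]]; apply; exact: le_trans tx.
rewrite measureD//; last by rewrite -ge0_fin_numE// fin_num_measure.
rewrite (_ : _ `&` _ = [set w | rv n w <= t]); last first.
  apply/seteqP; split=> w /=; first by case.
  by move=> h; split => //; exact: le_trans ttx.
rewrite fineD ?fineB ?fin_numB ?fin_num_measure ?addrA//.
Qed.

(** Integrate [bisection_root_cdf] over the cut, by independence, then replace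
    the [n]-th cut by the first one. *)
Lemma root_cdfS n x : 0 <= x <= 1 ->
  root_cdf n.+1 x = cdf_step P (c 0%N) (root_cdf n) x.
Proof.
move=> x01.
pose h (p : R * R) : \bar R := (\1_[set p | bisection_root_powR p <= x] p)%:E.
have mS : measurable [set p : R * R | bisection_root_powR p <= x].
  have -> : [set p : R * R | bisection_root_powR p <= x] =
      (@bisection_root_powR R) @^-1` `]-oo, x].
    by apply/seteqP; split=> w /=; rewrite in_itv.
  by rewrite -[X in measurable X]setTI; exact: measurable_bisection_root_powR.
have mh : measurable_fun setT h.
  by apply/measurable_EFinP; exact: measurable_indic.
have homoF := root_cdf_homo n.
pose g t := root_cdf n (t * x) + root_cdf n (t + (1 - t) * x) - root_cdf n t.
have mF : measurable_fun setT (root_cdf n) by exact: nondecreasing_measurable.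
have mg : measurable_fun setT g.
  apply: measurable_funB => //; apply: measurable_funD;
    apply: (measurableT_comp mF).
    exact: measurable_funM.
  apply: measurable_funD => //; apply: measurable_funM => //.
  exact: measurable_funB.
have g_le t : `|g t| <= 2.
  have := root_cdf01 n (t * x); have := root_cdf01 n (t + (1 - t) * x).
  by have := root_cdf01 n t; rewrite /g ler_norml; lra.
rewrite /cdf_step -[RHS]/(\int[P]_w g (c 0%N w)).
rewrite -(identically_distributed_Rintegral _ _ _ 2 n c_ident c01 mg) => [|//].
congr fine.
transitivity (\int[P]_w h (c n w, rv n w))%E.
  rewrite -[X in P X]setIT -integral_indic//; last exact: measurable_rv_le.
  apply: eq_integral => w _; rewrite /h !indicE; congr ((_ : bool)%:R)%:E.
  by apply/idP/idP; rewrite !inE/= rv_step bisection_root_powRE.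
rewrite (independent_integral _ _ _ _ (cut_root_independent n) mh) => [|z]; last first.
  by rewrite lee_fin indicE; case: (_ \in _).
apply: eq_integral => w _ /=; rewrite /g -bisection_root_cdf//.
have mset : measurable [set w' | bisection_root (c n w) (rv n w') <= x].
  have -> : [set w' | bisection_root (c n w) (rv n w') <= x] =
      (fun w' => bisection_root_powR (c n w, rv n w')) @^-1` `]-oo, x].
    apply/seteqP; split=> w' /=; rewrite in_itv/=;
      by rewrite bisection_root_powRE.
  rewrite -[X in measurable X]setTI.
  by apply: (measurableT_comp measurable_bisection_root_powR) => //;
    exact: measurable_fun_pair.
rewrite fineK ?fin_num_measure//.
rewrite -[X in P X]setIT -integral_indic//.
apply: eq_integral => w' _; rewrite /h !indicE; congr ((_ : bool)%:R)%:E.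
by apply/idP/idP; rewrite !inE/= bisection_root_powRE.
Qed.

(** Given the cut [t], the factor is [t] with probability [root_cdf n t] and
    [1 - t] otherwise. *)
Lemma factor_moment n k :
  \int[P]_w (bisection_factor (c n w) (rv n w)) ^+ k =
  \int[P]_w (c 0%N w ^+ k * root_cdf n (c 0%N w) +
             (1 - c 0%N w) ^+ k * (1 - root_cdf n (c 0%N w))).
Proof.
(* The absolute values make q nonnegative on the whole plane. *)
pose q (p : R * R) := if p.2 <= p.1 then `|p.1| ^+ k else `|1 - p.1| ^+ k.
pose h (p : R * R) : \bar R := (q p)%:E.
have q0 p : 0 <= q p by rewrite /q; case: ifP => _; exact: exprn_ge0.
have mq : measurable_fun setT q.
  apply: measurable_fun_ifT; first exact: measurable_fun_ler.
    by apply: measurable_funX; exact: measurableT_comp.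
  by apply: measurable_funX; apply: measurableT_comp => //; exact: measurable_funB.
have mh : measurable_fun setT h by exact/measurable_EFinP.
have mF : measurable_fun setT (root_cdf n).
  by apply: nondecreasing_measurable => //; exact: root_cdf_homo.
pose g t := t ^+ k * root_cdf n t + (1 - t) ^+ k * (1 - root_cdf n t).
have mg : measurable_fun setT g.
  by apply: measurable_funD; apply: measurable_funM => //;
    try apply: measurable_funX; exact: measurable_funB.
have g_le t : 0 <= t <= 1 -> `|g t| <= 1.
  move=> /andP[t0 t1]; have /andP[F0 F1] := root_cdf01 n t.
  have t'0 : 0 <= 1 - t by lra.
  have t'1 : 1 - t <= 1 by lra.
  have := exprn_ile1 k t0 t1; have := exprn_ge0 k t0.
  have := exprn_ile1 k t'0 t'1; have := exprn_ge0 k t'0.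
  rewrite /g; move: (t ^+ k) ((1 - t) ^+ k) => a b b0 b1 a0 a1.
  have F'0 : 0 <= 1 - root_cdf n t by lra.
  rewrite ger0_norm; last by rewrite addr_ge0// mulr_ge0.
  have := ler_piMl F0 a1; have := ler_piMl F'0 b1; lra.
rewrite -[RHS]/(\int[P]_w g (c 0%N w)).
rewrite -(identically_distributed_Rintegral _ _ _ 1 n c_ident c01 mg) => [|//].
congr fine.
transitivity (\int[P]_w h (c n w, rv n w))%E.
  apply: eq_integral => w _; have /andP[? ?] := c01 n w.
  rewrite /h /q /bisection_factor /=.
  by case: ifP => _; rewrite ger0_norm// subr_ge0.
rewrite (independent_integral _ _ _ _ (cut_root_independent n) mh) => [|z]; last first.
  by rewrite lee_fin.
apply: eq_integral => w _ /=.
have /andP[t0 t1] := c01 n w; set t := c n w in t0 t1 *.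
have t'0 : 0 <= 1 - t by lra.
have mb : measurable_fun setT (fun w' => rv n w' <= t) by exact: measurable_fun_ler.
have -> : g t = \int[P]_w' (if rv n w' <= t then t ^+ k else (1 - t) ^+ k).
  rewrite Rintegral_if; last exact: mb.
  by rewrite /g /root_cdf.
apply: etrans (integral_bounded_EFin P _ (`|t ^+ k| + `|(1 - t) ^+ k|) _ _).
- by apply: eq_integral => w' _; rewrite /h /q /= !ger0_norm.
- exact: measurable_fun_ifT.
- by move=> w' /=; case: ifP => _; rewrite ?lerDl ?lerDr.
Qed.

End process.

(** * Limits of the moments of the factor *)

Section density_cdf.
Context {d : measure_display} {Omega : measurableType d} {R : realType}.
Variables (P : probability Omega R) (Y : {RV P >-> R}).
Local Notation mu := (@lebesgue_measure R).

(** Integrability of the density on the unit interval comes from its total mass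
    being a probability. *)
Lemma density_cdf : has_density_on_unit_interval Y ->
  exists2 f : R -> R, mu.-integrable `[0, 1]%classic (EFin \o f) &
    forall x, 0 <= x <= 1 ->
      fine (P [set w | Y w <= x]) = \int[mu]_(t in `[0, x]) f t.
Proof.
move=> [f [mf f0 Yf]]; exists f.
  apply/integrableP; split; first exact/measurable_EFinP.
  have <- : (\int[mu]_(x in `[0%R, 1%R]) (f x)%:E =
             \int[mu]_(x in `[0%R, 1%R]) `|(EFin \o f) x|)%E.
    apply: eq_integral => x /=; rewrite inE/= in_itv/= => /f0 fx.
    by rewrite ger0_norm.
  have := Yf setT measurableT; rewrite setTI => <-.
  by rewrite probability_setT ltry.
move=> x /andP[x0 x1].
have -> : [set w | Y w <= x] = Y @^-1` `]-oo, x].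
  by apply/seteqP; split=> w /=; rewrite in_itv.
rewrite -[P _]/(distribution P Y _) Yf//.
congr fine; congr integral.
by apply/seteqP; split=> t /=; rewrite !in_itv/=; lra.
Qed.

End density_cdf.

Section moments.
Context {d : measure_display} {Omega : measurableType d} {R : realType}.
Variables (P : probability Omega R) (X : {RV P >-> R}).
Hypothesis X01 : forall w, 0 <= X w <= 1.

Lemma bounded_expectation (Y : Omega -> R) :
  measurable_fun setT Y -> (forall w, `|Y w| <= 1) ->
  'E_P[Y]%E = (\int[P]_w Y w)%:E.
Proof. by move=> mY bY; rewrite unlock (integral_bounded_EFin P Y 1). Qed.

Lemma bounded_variance (Y : Omega -> R) :
  measurable_fun setT Y -> (forall w, `|Y w| <= 1) ->
  'V_P[Y]%E = (\int[P]_w Y w ^+ 2 - (\int[P]_w Y w) ^+ 2)%:E.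
Proof.
move=> mY bY.
have mY2 : measurable_fun setT (fun w => Y w ^+ 2) by exact: measurable_funX.
have bY2 w : `|Y w ^+ 2| <= 1 by rewrite normrX exprn_ile1.
have Y1 : Y \in Lfun P 1 by apply/Lfun1_integrable; exact: bounded_integrable bY.
have Y21 : (Y * Y)%R \in Lfun P 1.
  by apply/Lfun1_integrable; exact: (bounded_integrable _ _ _ mY2 bY2).
rewrite /variance covarianceE// (bounded_expectation _ mY bY).
by rewrite -[(Y * Y)%R]/(fun w => Y w ^+ 2) (bounded_expectation _ mY2 bY2).
Qed.

(** Expand the variance as the second moment minus [mu ^ 2]. *)
Lemma cut_spread (mu sigma : R) : 'E_P[X]%E = mu%:E -> 'V_P[X]%E = (sigma ^+ 2)%:E ->
  \int[P]_w (X w * (1 - X w)) = mu - mu ^+ 2 - sigma ^+ 2.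
Proof.
have bX w : `|X w| <= 1 by have /andP[? ?] := X01 w; rewrite ger0_norm.
have bX2 w : `|X w ^+ 2| <= 1 by rewrite normrX exprn_ile1.
have mX2 : measurable_fun setT (fun w => X w ^+ 2) by exact: measurable_funX.
rewrite bounded_variance// bounded_expectation// => -[EX] [].
rewrite EX => VX.
have -> : mu - mu ^+ 2 - sigma ^+ 2 = mu - \int[P]_w X w ^+ 2 by rewrite -VX; ring.
have iX := bounded_integrable P X 1 (measurable_funPT X) bX.
have iX2 := bounded_integrable P _ 1 mX2 bX2.
rewrite -EX -(RintegralB measurableT iX iX2).
by apply: eq_Rintegral => w _; ring.
Qed.

Lemma uniform_moment_integrable k :
  P.-integrable setT (EFin \o (fun w => X w ^+ k * X w + (1 - X w) ^+ k * (1 - X w))).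
Proof.
apply: (@bounded_integrable _ _ _ P _ 1).
  apply: measurable_funD; apply: measurable_funM => //;
    try apply: measurable_funX => //; exact: measurable_funB.
move=> w; have /andP[x0 x1] := X01 w.
have x'0 : 0 <= 1 - X w by lra.
have x'1 : 1 - X w <= 1 by lra.
rewrite ger0_norm; last by rewrite addr_ge0// mulr_ge0// exprn_ge0.
have := ler_piMl x0 (exprn_ile1 k x0 x1); have := ler_piMl x'0 (exprn_ile1 k x'0 x'1).
lra.
Qed.

(** For a uniform root, the factor given the cut [t] is [t] with probability [t]
    and [1 - t] with probability [1 - t]; this and the next lemma compute its
    first two moments in terms of the mean of [X * (1 - X)]. *)
Lemma uniform_moment1 :
  \int[P]_w (X w ^+ 1 * X w + (1 - X w) ^+ 1 * (1 - X w)) =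
  1 - 2 * \int[P]_w (X w * (1 - X w)).
Proof.
by rewrite -contraction_rateE//; apply: eq_Rintegral => w _; rewrite !expr1 !expr2.
Qed.

Lemma uniform_moment2 :
  \int[P]_w (X w ^+ 2 * X w + (1 - X w) ^+ 2 * (1 - X w)) =
  1 - 3 * \int[P]_w (X w * (1 - X w)).
Proof.
have iq : P.-integrable setT (EFin \o (fun w => X w * (1 - X w))).
  apply: (@bounded_integrable _ _ _ P _ 1).
    by apply: measurable_funM => //; exact: measurable_funB.
  by move=> w; have /andP[? ?] := X01 w; rewrite ger0_norm; nra.
have i1 : P.-integrable setT (EFin \o (fun=> 1 : R)).
  by apply: (@bounded_integrable _ _ _ P _ 1) => // w; rewrite normr1.
have i3 : P.-integrable setT (EFin \o (fun w => 3 * (X w * (1 - X w)))).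
  by apply: eq_integrable (integrableZl measurableT 3 iq).
rewrite -(RintegralZl 3 measurableT iq).
rewrite [X in _ = X - _](_ : 1 = \int[P]_w 1); last first.
  by rewrite Rintegral_cst//= probability_setT mulr1.
rewrite -(RintegralB measurableT i1 i3).
by apply: eq_Rintegral => w _; ring.
Qed.

End moments.

Section factor.
Context {d : measure_display} {Omega : measurableType d} {R : realType}.
Variables (P : probability Omega R) (c rv : nat -> {RV P >-> R}).
Hypothesis c01 : forall n w, 0 <= c n w <= 1.
Hypothesis c_indep : mutually_independent c.
Hypothesis c_ident : identically_distributed c.
Hypothesis rv01 : forall n w, 0 <= rv n w <= 1.
Hypothesis rv0_indep : independent_of_sequence (rv 0%N) c.
Hypothesis rv_step : forall n w, rv n.+1 w = bisection_root (c n w) (rv n w).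
Hypothesis rv0_ac : has_density_on_unit_interval (rv 0%N).
Hypothesis c_inner : (0 < P [set w | (0 < c 0%N w < 1)%R])%E.

Lemma root_cdf_unif_cvg eps : 0 < eps ->
  \forall n \near \oo, forall x, 0 <= x <= 1 -> `|root_cdf P rv n x - x| <= eps.
Proof.
move=> eps0.
have [f intf Ff] := density_cdf P (rv 0%N) rv0_ac.
apply: (cdf_step_unif_cvg P (c 0%N)) => //.
- exact: root_cdf_homo.
- by move=> n x _; exact: root_cdf01.
- by rewrite /root_cdf Ff ?lexx ?ler01// set_itv1 Rintegral_set1.
- exact: root_cdf1.
- by move=> n x x01; exact: root_cdfS.
move=> e e0; have [E [K [homoE K0 E01 mF]]] := density_midpoint_bound f e intf e0.
exists E, K; split => // a b a0 ab b1.
apply: le_trans (mF a b a0 ab b1).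
by rewrite /midpoint_defect /root_cdf !Ff//; lra.
Qed.

(** Replacing the distribution function of the root by the identity changes the
    integrand by [(b - a) * (F t - t)] with [a] and [b] in [[0, 1]], so the error
    is at most the uniform distance between the two functions. *)
Lemma factor_moment_cvg k :
  \int[P]_w (bisection_factor (c n w) (rv n w)) ^+ k @[n --> \oo] -->
  \int[P]_w (c 0%N w ^+ k * c 0%N w + (1 - c 0%N w) ^+ k * (1 - c 0%N w)).
Proof.
apply/cvgrPdist_le => eps eps0.
have := root_cdf_unif_cvg eps eps0; apply: filterS => n Fn.
rewrite (factor_moment P c rv)//.
set F := root_cdf P rv n in Fn *.
have mF : measurable_fun setT F.
  by apply: nondecreasing_measurable => //; exact: root_cdf_homo.
have mFc : measurable_fun setT (F \o c 0%N) by exact: measurableT_comp.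
have F01 t : 0 <= F t <= 1 by exact: root_cdf01.
have bounds w : [/\ 0 <= c 0%N w ^+ k, c 0%N w ^+ k <= 1,
    0 <= (1 - c 0%N w) ^+ k & (1 - c 0%N w) ^+ k <= 1].
  have /andP[x0 x1] := c01 0%N w.
  by split; rewrite ?exprn_ge0 ?exprn_ile1//; lra.
have iF : P.-integrable setT (EFin \o (fun w => c 0%N w ^+ k * F (c 0%N w) +
    (1 - c 0%N w) ^+ k * (1 - F (c 0%N w)))).
  apply: (@bounded_integrable _ _ _ P _ 1).
    by apply: measurable_funD; apply: measurable_funM => //;
      try apply: measurable_funX => //; exact: measurable_funB.
  move=> w; have [a0 a1 b0 b1] := bounds w; have /andP[f0 f1] := F01 (c 0%N w).
  have f'0 : 0 <= 1 - F (c 0%N w) by lra.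
  rewrite ger0_norm; last by rewrite addr_ge0// mulr_ge0.
  have := ler_piMl f0 a1; have := ler_piMl f'0 b1; lra.
have iU := uniform_moment_integrable P (c 0%N) (c01 0%N) k.
rewrite -(RintegralB measurableT iU iF).
have idiff := integrableB measurableT iU iF.
have -> : eps = \int[P]_w eps by rewrite Rintegral_cst//= probability_setT mulr1.
apply: le_trans (le_normr_Rintegral measurableT idiff) _.
apply: le_Rintegral => //.
- by apply: eq_integrable (integrable_abse idiff).
- by apply: (@bounded_integrable _ _ _ P _ `|eps|).
move=> w _ /=; have [a0 a1 b0 b1] := bounds w; have := Fn _ (c01 0%N w).
set t := c 0%N w; move: (t ^+ k) ((1 - t) ^+ k) a0 a1 b0 b1 => a b a0 a1 b0 b1 FT.
have -> : a * t + b * (1 - t) - (a * F t + b * (1 - F t)) = (b - a) * (F t - t).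
  by ring.
rewrite normrM; apply: le_trans FT; rewrite ler_piMl//.
by rewrite ler_norml; lra.
Qed.

End factor.

Theorem corollary14 (R : realType) (d : measure_display)
    (Omega : measurableType d) (P : probability Omega R)
    (c : nat -> {RV P >-> R}) (r0 : {RV P >-> R})
    (r ell : nat -> Omega -> R) (mu sigma : R)
    (c_range : forall n w, 0 <= c n w <= 1)
    (c_indep : mutually_independent c)
    (c_ident : identically_distributed c)
    (c_mean : 'E_P[c 0%N]%E = mu%:E)
    (c_var : 'V_P[c 0%N]%E = (sigma ^+ 2)%:E)
    (r0_range : forall w, 0 <= r0 w <= 1)
    (r0_indep : independent_of_sequence r0 c)
    (r_init : forall w, r 0%N w = r0 w)
    (r_step : forall n w, r n.+1 w = bisection_root (c n w) (r n w))
    (ell_step : forall n w, ell n.+1 w = bisection_factor (c n w) (r n w))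
    (r0_ac : has_density_on_unit_interval r0)
    (c_inner : (0 < P [set w | (0 < c 0%N w < 1)%R])%E) :
  ('E_P[ell n]%E @[n --> \oo] --> (1 - 2 * (mu - mu ^+ 2 - sigma ^+ 2))%:E) /\
  ('V_P[ell n]%E @[n --> \oo] -->
     ((mu - mu ^+ 2 - sigma ^+ 2) *
      (1 - 4 * (mu - mu ^+ 2 - sigma ^+ 2)))%:E).
Proof.
have mr n : measurable_fun setT (r n).
  elim: n => [|n IH]; first by rewrite (_ : r 0%N = r0)//; exact/funext.
  have -> : r n.+1 = fun w => bisection_root_powR (c n w, r n w).
    by apply/funext => w; rewrite r_step bisection_root_powRE.
  apply: (measurableT_comp measurable_bisection_root_powR).
  exact: measurable_fun_pair.
(* The positions of the root, packed as random variables. *)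
pose rv n : {RV P >-> R} := HB.pack (r n) (isMeasurableFun.Build _ _ _ _ _ (mr n)).
have rv0E : rv 0%N = r0 :> (Omega -> R) by apply/funext => w; exact: r_init.
have rv01 n w : 0 <= rv n w <= 1.
  elim: n => [|n /andP[IH0 IH1]]; first by rewrite /= r_init.
  have /andP[t0 t1] := c_range n w.
  rewrite /= r_step /bisection_root; case: ifPn => [rt|]; last rewrite -ltNge => tr.
    have [t_gt0|t_le0] := ltP 0 (c n w).
      by rewrite divr_ge0//= ler_pdivrMr// mul1r.
    have tE : c n w = 0 by lra.
    by rewrite tE invr0 mulr0 lexx ler01.
  have t'0 : 0 < 1 - c n w by move: IH1 => /= IH1; lra.
  by move: IH1 => /= IH1; rewrite divr_ge0/= ?ler_pdivrMr//; lra.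
have rv0_indep : independent_of_sequence (rv 0%N) c.
  by move=> A B; rewrite rv0E; exact: r0_indep.
have rv0_ac : has_density_on_unit_interval (rv 0%N).
  case: r0_ac => f [mf f0 fE]; exists f; split => // B mB.
  by rewrite -fE// /distribution rv0E.
have cvgm := factor_moment_cvg P c rv c_range c_indep c_ident rv01 rv0_indep
  r_step rv0_ac c_inner.
pose ellv n w := bisection_factor (c n w) (rv n w).
have ellE n : ell n.+1 = ellv n by apply/funext => w; exact: ell_step.
have mell n : measurable_fun setT (ellv n).
  apply: measurable_fun_ifT => //; last exact: measurable_funB.
  exact: measurable_fun_ler.
have bell n w : `|ellv n w| <= 1.
  rewrite /ellv /bisection_factor; have /andP[t0 t1] := c_range n w.
  by case: ifP => _; rewrite ger0_norm; lra.
have spread := cut_spread P (c 0%N) (c_range 0%N) _ _ c_mean c_var.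
have m1 := cvgm 1%N; rewrite uniform_moment1// spread in m1.
have m2 := cvgm 2%N; rewrite uniform_moment2// spread in m2.
have m1' : \int[P]_w ellv n w @[n --> \oo] --> 1 - 2 * (mu - mu ^+ 2 - sigma ^+ 2).
  exact: m1.
(* The recursion determines ell only from index 1 on. *)
split; rewrite -cvg_shiftS /=.
  under eq_cvg do rewrite ellE (bounded_expectation P _ (mell _) (bell _)).
  by apply: cvg_EFin => /=; [exact: nearW|exact: m1'].
under eq_cvg do rewrite ellE (bounded_variance P _ (mell _) (bell _)).
apply: cvg_EFin => /=; first exact: nearW.
have -> : (mu - mu ^+ 2 - sigma ^+ 2) * (1 - 4 * (mu - mu ^+ 2 - sigma ^+ 2)) =
    1 - 3 * (mu - mu ^+ 2 - sigma ^+ 2) -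
    (1 - 2 * (mu - mu ^+ 2 - sigma ^+ 2)) ^+ 2 by ring.
apply: cvgB m2 _.
exact: (cvgM m1' m1').
Qed.
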